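(* For any integer $t\geq 0$, there exist a graph $H=(V,E)$ and an edge $e\in E$ such that $\operatorname{ppt}(H/e)\leq \operatorname{ppt}(H)-t$, where $H/e$ is the graph obtained from $H$ by contracting the edge $e$.
   Context: All graphs are finite and simple. For an edge $e=uv$ of $H$, the graph $H/e$ obtained by contracting $e$ results from identifying $u$ and $v$ as a single vertex $w$ with $N(w)=(N(u)\cup N(v))\setminus\{u,v\}$. For a graph $G$ and $S\subseteq V(G)$, let $N(v)$ be the set of neighbors of $v$ and $N[S]=S\cup\bigcup_{s\in S}N(s)$. Define $S^{[0]}=S$, $S^{[1]}=N[S]$, and for $i\geq 1$, $S^{[i+1]}=S^{[i]}\cup\{w\in V(G) : \exists\, v\in S^{[i]},\ N(v)\setminus S^{[i]}=\{w\}\}$. The set $S$ is a power dominating set of $G$ if $S^{[\ell]}=V(G)$ for some $\ell$; a minimum power dominating set is one of minimum cardinality. For a power dominating set $S$, $\operatorname{ppt}(G,S)$ is the smallest $\ell\ge 0$ with $S^{[\ell]}=V(G)$. The power propagation time of $G$ is $\operatorname{ppt}(G)=\min\{\operatorname{ppt}(G,S) : S \text{ is a minimum power dominating set of } G\}$. *)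

(* Defs.v *)
From mathcomp Require Import all_boot.
From mathcomp Require Import boolp.

Set Implicit Arguments.
Unset Strict Implicit.
Unset Printing Implicit Defensive.

Record sgraph := SGraph {
  vertex :> finType;
  adj : rel vertex;
  adj_sym : symmetric adj;
  adj_irrefl : irreflexive adj
}.

Section Contraction.
Variables (G : sgraph) (u v : G).

(* [None] is the vertex w that replaces u and v. *)
Definition contract_vertex : finType := option {x : G | x \notin [set u; v]}.

Definition contract_adj : rel contract_vertex := fun a b =>
  match a, b with
  | Some x, Some y => adj (val x) (val y)
  | None, Some y => adj u (val y) || adj v (val y)
  | Some x, None => adj u (val x) || adj v (val x)
  | None, None => false
  end.

Lemma contract_adj_sym : symmetric contract_adj.
Proof. by move=> [x|] [y|] //=; rewrite adj_sym. Qed.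

Lemma contract_adj_irrefl : irreflexive contract_adj.
Proof. by move=> [x|] //=; rewrite adj_irrefl. Qed.

(* The contraction G / uv; it is meant for u and v adjacent. *)
Definition contract : sgraph := SGraph contract_adj_sym contract_adj_irrefl.

End Contraction.

Section PowerDomination.
Variable G : sgraph.
Implicit Types (S T : {set G}) (v w : G).

Definition nbrs v : {set G} := [set w | adj v w].

Definition closed_nbrs S : {set G} := S :|: \bigcup_(s in S) nbrs s.

Definition force S : {set G} :=
  S :|: [set w | [exists v in S, nbrs v :\: S == [set w]]].

(* [observed S i] is S^[i]: the first step is a domination step, all later
   ones are forcing steps. *)
Fixpoint observed S (i : nat) : {set G} :=
  match i with
  | 0 => S
  | 1 => closed_nbrs S
  | j.+1 => force (observed S j)
  end.

Definition power_dominating S : Prop := exists l, observed S l == setT.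

Definition min_power_dominating S : Prop :=
  power_dominating S /\ forall T, power_dominating T -> #|S| <= #|T|.

Definition ppt_set S (pdS : power_dominating S) : nat := ex_minn pdS.

Definition ppt_value (k : nat) : Prop :=
  exists S (mS : min_power_dominating S), ppt_set mS.1 = k.

Lemma ppt_value_ex : exists k, `[< ppt_value k >].
Proof.
have exP : exists n, `[< exists2 S, power_dominating S & #|S| = n >].
  by exists #|[set: G]|; apply/asboolP; exists setT => //; exists 0.
case: (ex_minnP exP) => n /asboolP[S pdS <-] minS.
have mS : min_power_dominating S.
  by split=> // T pdT; apply: minS; apply/asboolP; exists T.
by exists (ppt_set mS.1); apply/asboolP; exists S, mS.
Qed.

Definition ppt : nat := ex_minn ppt_value_ex.

End PowerDomination.

(* Main.v *)
Require Import Defs.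
From mathcomp Require Import all_boot.
From mathcomp Require Import boolp zify.

Set Implicit Arguments.
Unset Strict Implicit.
Unset Printing Implicit Defensive.

(** The graph H is a cycle s, p_1, ..., p_n, u, together with a vertex v
    adjacent to both u and p_n, and three pendant vertices at s.

    A set of size one that avoids s misses two of the pendant vertices, and
    their only neighbour s can then force neither of them
    ([power_dominating_pendants]).  Hence [{s}] is the only minimum power
    dominating set of H ([unique_pds]).  After the domination step from s, the
    vertex u is observed but cannot force, because both of its neighbours v and
    p_n are unobserved.  All further propagation therefore runs one way along
    p_1, p_2, ..., and needs n steps to reach p_n ([ppt_slow]).

    Contracting uv removes the obstruction: the merged vertex is observed after
    the domination step, and p_n is its only unobserved neighbour.  The
    propagation now runs along the cycle from both ends and needs about n/2
    steps ([ppt_contract_le]).  Taking n = 2t + 1 saves t steps. *)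

(** * Power domination in general graphs *)

Section PowerDominationFacts.
Variable G : sgraph.
Implicit Types (S T : {set G}) (x y w : G).

Lemma closed_nbrsP S w :
  reflect (w \in S \/ exists2 x, x \in S & adj x w) (w \in closed_nbrs S).
Proof.
rewrite /closed_nbrs in_setU.
apply: (iffP orP) => -[wS|]; [by left| |by left|].
  by case/bigcupP=> x xS; rewrite inE => xw; right; exists x.
by case=> x xS xw; right; apply/bigcupP; exists x; rewrite ?inE.
Qed.

(** The uniqueness of the unobserved neighbour is stated pointwise, so that it
    can be used, and proved, by comparing adjacencies; [w] itself may already
    be observed. *)
Lemma forceP T w :
  reflect (w \in T \/ exists x, [/\ x \in T, adj x w
             & forall y, adj x y -> y \notin T -> y = w])
          (w \in force T).
Proof.
rewrite /force in_setU inE.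
apply: (iffP orP) => -[wT|]; [by left| |by left|].
  case/exists_inP=> x xT /eqP Dx; right; exists x; split=> //.
    have: w \in nbrs x :\: T by rewrite Dx set11.
    by rewrite !inE => /andP[].
  move=> y xy yT; apply/set1P; rewrite -Dx !inE yT.
  exact: xy.
case=> x [xT xw Ux]; case: (boolP (w \in T)) => wT; [by left | right].
apply/exists_inP; exists x => //; apply/eqP/setP=> y; rewrite !inE.
apply/andP/eqP => [[yT xy]|->]; last by split.
exact: Ux.
Qed.

Lemma force_mono S T : S \subset T -> force S \subset force T.
Proof.
move=> /subsetP sST; apply/subsetP=> w /forceP[wS|[x [xS xw Ux]]].
  by apply/forceP; left; apply: sST.
apply/forceP; right; exists x; split=> // [|y xy yT]; first exact: sST.
by apply: Ux => //; apply: contra yT; apply: sST.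
Qed.

Lemma observed_upper S (B : nat -> {set G}) :
    S \subset B 0 -> closed_nbrs S \subset B 1 ->
    (forall i, force (B i.+1) \subset B i.+2) ->
  forall i, observed S i \subset B i.
Proof.
move=> B0 B1 Bs [//|i]; elim: i => [//|i IHi].
exact: subset_trans (force_mono IHi) (Bs i).
Qed.

Lemma observed_lower S (B : nat -> {set G}) :
    B 1 \subset closed_nbrs S ->
    (forall i, B i.+2 \subset force (B i.+1)) ->
  forall i, B i.+1 \subset observed S i.+1.
Proof.
move=> B1 Bs; elim=> [//|i IHi].
exact: subset_trans (Bs i) (force_mono IHi).
Qed.

Lemma observed_set0 i : observed (set0 : {set G}) i = set0.
Proof.
case: i => [//|i]; elim: i => [|i IHi].
  apply/setP=> x; rewrite [RHS]inE.
  by apply/closed_nbrsP=> -[|[y]]; rewrite inE.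
rewrite -[LHS]/(force (observed set0 i.+1)) IHi.
by apply/setP=> x; rewrite [RHS]inE; apply/forceP=> -[|[y []]]; rewrite inE.
Qed.

Lemma power_dominating_gt0 (x : G) S : power_dominating S -> 0 < #|S|.
Proof.
case=> i /eqP DS; rewrite card_gt0; apply/eqP=> S0.
by move/setP/(_ x): DS; rewrite S0 observed_set0 !inE.
Qed.

(** If [S] avoids all three vertices, only [s] could force [a] or [b], and it
    always has both of them as unobserved neighbours. *)
Lemma power_dominating_pendants S s a b :
    a != b -> adj s a -> adj s b ->
    (forall x, adj x a -> x = s) -> (forall x, adj x b -> x = s) ->
  power_dominating S -> [|| s \in S, a \in S | b \in S].
Proof.
move=> ab sa sb Ua Ub [i /eqP DS]; apply: contraT => /norP[sS /norP[aS bS]].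
pose B (j : nat) := ~: [set a; b].
have SB: S \subset B 0.
  by apply/subsetP=> x xS; rewrite !inE; apply/norP; split;
     apply: contraTneq xS => ->.
have sBi : forall j, observed S j \subset B j.
  apply: observed_upper => // [|j].
    apply/subsetP=> x /closed_nbrsP[/(subsetP SB) //|[y yS yx]].
    rewrite !inE; apply/norP; split; apply: contraNneq sS => Dx;
      by rewrite Dx in yx; rewrite -?(Ua _ yx) -?(Ub _ yx).
  apply/subsetP=> x /forceP[//|[y [_ yx Uy]]]; rewrite !inE.
  apply/norP; split; apply: contra_neqN ab => /eqP Dx; rewrite Dx in yx Uy.
    by apply/esym/Uy; rewrite ?(Ua _ yx) // !inE eqxx orbT.
  by apply/Uy; rewrite ?(Ub _ yx) // !inE eqxx.
by have:= subsetP (sBi i) a; rewrite DS !inE eqxx => /(_ isT).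
Qed.

Lemma ppt_leq (x : G) k : observed [set x] k = setT -> ppt G <= k.
Proof.
move=> Dk; have pdx : power_dominating [set x] by exists k; apply/eqP.
have mx : min_power_dominating [set x].
  by split=> // T /(power_dominating_gt0 x); rewrite cards1.
rewrite /ppt; case: ex_minnP => m _ /(_ (ppt_set mx.1)) le_m.
apply: leq_trans (le_m _) _; first by apply/asboolP; exists [set x], mx.
by rewrite /ppt_set; case: ex_minnP => l _ /(_ k); apply; apply/eqP.
Qed.

Lemma ppt_geq k :
    (forall S l, min_power_dominating S -> observed S l = setT -> k <= l) ->
  k <= ppt G.
Proof.
move=> lb; rewrite /ppt; case: ex_minnP => m /asboolP[S [mS <-]] _.
by rewrite /ppt_set; case: ex_minnP => l /eqP /(lb S l mS).
Qed.

End PowerDominationFacts.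

(** * The slow graph *)

Section SlowGraph.
Variable n : nat.

(** The vertex s is 0, p_i is i for 1 <= i <= n, u is n + 1, v is n + 2, and the
    pendant vertices are the last three. *)
Definition slow_edge (i j : nat) : bool :=
  [|| (j == i.+1) && (i <= n.+1),
      (i == 0) && ((j == n.+1) || (n.+3 <= j))
    | (i == n) && (j == n.+2)].

Definition slow_adj : rel 'I_n.+4.+2 :=
  fun i j => slow_edge i j || slow_edge j i.

Lemma slow_adj_sym : symmetric slow_adj.
Proof. by move=> i j; rewrite /slow_adj orbC. Qed.

Lemma slow_adj_irrefl : irreflexive slow_adj.
Proof. by move=> i; rewrite /slow_adj /slow_edge; lia. Qed.

Definition slow : sgraph := SGraph slow_adj_sym slow_adj_irrefl.

Definition pos (x : slow) : nat := nat_of_ord x.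
Definition pt (i : nat) : slow := inord i.

Lemma pos_pt i : i < n.+4.+2 -> pos (pt i) = i.
Proof. exact: inordK. Qed.

Lemma pos_lt (x : slow) : pos x < n.+4.+2.
Proof. exact: ltn_ord. Qed.

Lemma pos_inj : injective pos.
Proof. exact: val_inj. Qed.

Lemma pos_eq (x : slow) i : i < n.+4.+2 -> (x == pt i) = (pos x == i).
Proof. by move=> lti; rewrite -(inj_eq pos_inj) pos_pt. Qed.

Lemma slow_adjE (x y : slow) :
  adj x y = slow_edge (pos x) (pos y) || slow_edge (pos y) (pos x).
Proof. by []. Qed.

(** From s, the path is observed in order, and v after it. *)
Lemma center_observed : observed [set pt 0] n.+2 = setT.
Proof.
pose B i := [set x : slow | [|| pos x <= i, pos x == n.+1 | n.+3 <= pos x]].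
have DB : B n.+2 = setT by apply/setP=> x; rewrite !inE; lia.
apply/eqP; rewrite -subTset -DB; apply: observed_lower => [|i].
  apply/subsetP=> x; rewrite inE => Bx; apply/closed_nbrsP.
  case: (posnP (pos x)) => x0; [left | right].
    by rewrite inE pos_eq ?x0.
  exists (pt 0); first exact: set11.
  by rewrite slow_adjE pos_pt // /slow_edge; lia.
apply/subsetP=> x; rewrite inE => Bx; apply/forceP.
case: (boolP (x \in B i.+1)) => nBx; [by left | right].
rewrite inE in nBx; have x_lt := pos_lt x.
(* The last step is the case i = n: position n + 1, which is u, forces v. *)
exists (pt i.+1); rewrite inE slow_adjE pos_pt; try lia.
split=> [||y]; rewrite ?inE ?slow_adjE ?pos_pt /slow_edge; try lia.
by move=> iy By; apply: pos_inj; have := pos_lt y; lia.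
Qed.

(** If 0 is missing, every pair of pendant vertices must meet S; three pendant
    vertices then make S contain two of them. *)
Lemma unique_pds (S : {set slow}) : min_power_dominating S -> S = [set pt 0].
Proof.
case=> pdS /(_ [set pt 0]); rewrite cards1 => leS.
have {}leS : #|S| <= 1 by apply: leS; exists n.+2; apply/eqP/center_observed.
have pend i j : n.+3 <= i -> i < j -> j < n.+4.+2 ->
    [|| pt 0 \in S, pt i \in S | pt j \in S].
  move=> le_i ltij lt_j; apply: power_dominating_pendants => // [|||x|x].
  - by rewrite pos_eq // pos_pt; lia.
  - by rewrite slow_adjE !pos_pt /slow_edge; lia.
  - by rewrite slow_adjE !pos_pt /slow_edge; lia.
  - rewrite slow_adjE pos_pt /slow_edge => [xi|]; last lia.
    by apply/eqP; rewrite pos_eq //; have := pos_lt x; lia.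
  - rewrite slow_adjE pos_pt /slow_edge => [xi|]; last lia.
    by apply/eqP; rewrite pos_eq //; have := pos_lt x; lia.
have uniqS x y : x \in S -> y \in S -> pos x = pos y.
  by move=> xS yS; congr pos; move/card_le1_eqP: leS; apply.
have S0 : pt 0 \in S.
  apply: contraT => /negPf nS0.
  have pos_in i j := uniqS (pt i) (pt j).
  have := pend n.+3 n.+4; have := pend n.+3 n.+4.+1; have := pend n.+4 n.+4.+1.
  have := pos_in n.+3 n.+4; have := pos_in n.+3 n.+4.+1.
  have := pos_in n.+4 n.+4.+1.
  rewrite nS0 !pos_pt; lia.
apply/setP=> x; rewrite inE; apply/idP/eqP => [xS|->//]; exact/pos_inj/uniqS.
Qed.

(** As long as p_n is
    unobserved, so is v, hence u does not force and only the front coming from s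
    advances. *)
Lemma ppt_slow : 0 < n -> n <= ppt slow.
Proof.
move=> n_gt0.
(* The last disjunct makes the bound vacuous from step n on. *)
pose B i := [set x : slow |
  [|| pos x <= i, pos x == n.+1, n.+3 <= pos x | n <= i]].
apply: ppt_geq => S l /unique_pds-> DS.
have/subsetP/(_ (pt n.+2)): observed [set pt 0] l \subset B l; last first.
  by rewrite DS !inE pos_pt => [/(_ isT)|]; lia.
apply: observed_upper => [||i]; apply/subsetP=> x.
- by rewrite !inE => /eqP->; rewrite pos_pt.
- case/closed_nbrsP=> [|[y]]; rewrite !inE => /eqP-> //.
    by rewrite pos_pt.
  by rewrite slow_adjE pos_pt // /slow_edge; have := pos_lt x; lia.
case/forceP=> [|[y []]]; first by rewrite !inE; lia.
rewrite !inE slow_adjE /slow_edge => By yx Uy; apply: contraT => nBx.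
have [yu|yu] := eqVneq (pos y) n.+1.
  (* y is u, and it cannot force: both v and p_n are unobserved. *)
  have n_lt : n < n.+4.+2 by lia.
  have v_lt : n.+2 < n.+4.+2 by lia.
  have {}Uy z yz zB := congr1 pos (Uy z yz zB).
  have := Uy (pt n); have := Uy (pt n.+2).
  by rewrite !inE !slow_adjE !pos_pt // /slow_edge; lia.
lia.
Qed.

(** * The contracted graph *)

Let u_lt : n.+1 < n.+4.+2. Proof. lia. Qed.
Let v_lt : n.+2 < n.+4.+2. Proof. lia. Qed.

Notation contracted := (contract (pt n.+1) (pt n.+2)).

(** The merged vertex keeps the position n + 1 of u. *)
Definition cpos (x : contracted) : nat :=
  if x is Some y then pos (val y) else n.+1.

Lemma pos_kept (x : slow) :
  (x \notin [set pt n.+1; pt n.+2]) = (pos x != n.+1) && (pos x != n.+2).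
Proof. by rewrite !inE !pos_eq // negb_or. Qed.

Lemma cpos_neq (x : contracted) : cpos x != n.+2.
Proof.
by case: x => [[y Hy]|] /=; [move: Hy; rewrite pos_kept => /andP[] | lia].
Qed.

Lemma cpos_inj : injective cpos.
Proof.
case=> [[x Hx]|] [[y Hy]|] //= Dxy.
- by congr Some; apply/val_inj/pos_inj.
- by have := Hx; rewrite pos_kept Dxy eqxx.
- by have := Hy; rewrite pos_kept -Dxy eqxx.
Qed.

Lemma cpos_surj i : i < n.+4.+2 -> i != n.+2 -> exists x, cpos x = i.
Proof.
move=> lti i_neq; have [->|i_neq1] := eqVneq i n.+1; first by exists None.
have Hi : pt i \notin [set pt n.+1; pt n.+2].
  by rewrite pos_kept pos_pt // i_neq1.
by exists (Some (exist _ (pt i) Hi)); rewrite /= pos_pt.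
Qed.

(** Since v brings no neighbour that u does not already have, the contraction
    deletes v: what remains is the cycle on the positions 0, ..., n + 1 and the
    pendant vertices at 0. *)
Lemma contract_adjE (x y : contracted) : adj x y =
  [|| (cpos x <= n) && (cpos y == (cpos x).+1),
      (cpos y <= n) && (cpos x == (cpos y).+1),
      (cpos x == 0) && (n < cpos y) | (cpos y == 0) && (n < cpos x)].
Proof.
case: x y => [[x Hx]|] [[y Hy]|] /=; last lia;
  rewrite -[slow_adj]/(@adj slow) !slow_adjE ?pos_pt // /slow_edge;
  try (have := Hx; rewrite pos_kept); try (have := Hy; rewrite pos_kept); lia.
Qed.

(** After i >= 1 steps the cycle is observed up to position i from one side and
    down to position n + 2 - i from the other. *)
Lemma ppt_contract_le k : n < k.*2 -> ppt contracted <= k.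
Proof.
move=> lt_k.
have k_gt0 : 0 < k by lia.
have [c c0] : exists c, cpos c = 0 by apply: cpos_surj; lia.
pose B i := [set x : contracted | (cpos x <= i) || (n.+2 <= cpos x + i)].
have DB : B k = setT by apply/setP=> x; rewrite !inE; lia.
apply: (ppt_leq (x := c)); apply/eqP; rewrite -subTset -DB.
rewrite -(prednK k_gt0); apply: observed_lower => [|i].
  apply/subsetP=> x; rewrite inE => Bx; apply/closed_nbrsP.
  have [x0|x_neq0] := eqVneq (cpos x) 0; [left | right].
    by rewrite inE; apply/eqP/cpos_inj; rewrite x0.
  by exists c; rewrite ?set11 // contract_adjE c0; lia.
apply/subsetP=> x; rewrite inE => Bx; apply/forceP.
case: (boolP (x \in B i.+1)) => nBx; [by left | right].
rewrite inE in nBx; have x_neq := cpos_neq x.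
(* An observed vertex of the cycle next to [x], on the side from which the
   propagation arrives, forces [x]. *)
have force_from j : j < n.+4.+2 -> j != n.+2 -> 0 < j <= n.+1 ->
    (j <= i.+1) || (n.+2 <= j + i.+1) ->
    (cpos x == j.+1) && (j <= i.+1) || (cpos x == j.-1) && (n.+2 <= j + i.+1) ->
  exists y, [/\ y \in B i.+1, adj y x
    & forall z, adj y z -> z \notin B i.+1 -> z = x].
  move=> lt_j j_neq j_cyc Bj xj; have [y Dy] := cpos_surj lt_j j_neq.
  exists y; rewrite inE contract_adjE Dy; split; try lia.
  move=> z; rewrite contract_adjE inE Dy => yz nBz; apply: cpos_inj.
  by have := cpos_neq z; lia.
have [x_le|x_gt] := leqP (cpos x) i.+2.
  by apply: (force_from i.+1); lia.
by apply: (force_from (n.+1 - i)); lia.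
Qed.

End SlowGraph.

Theorem corollary20 (t : nat) :
  exists (H : sgraph) (u v : H), adj u v /\ ppt (contract u v) + t <= ppt H.
Proof.
exists (slow t.*2.+1), (pt _ t.*2.+2), (pt _ t.*2.+3); split.
  by rewrite slow_adjE !pos_pt /slow_edge; lia.
have le_ppt := @ppt_contract_le t.*2.+1 t.+1 ltac:(lia).
by have := @ppt_slow t.*2.+1 (ltn0Sn _); lia.
Qed.
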